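(* Let $\tilde\otimes:\mathcal Z^1(\mathbb P^\infty)\times\mathcal Z^1(\mathbb P^\infty)\to\mathcal Z^1(\mathbb P^\infty)$ be the biadditive pairing on codimension-$1$ cycles induced by the product $f\,\tilde\otimes\,g$ of homogeneous polynomials defined in the context, and let $\hat\otimes$ be the associated reduced pairing $$\hat\otimes(\eta,\xi):=\eta\,\tilde\otimes\,\xi+\eta\,\tilde\otimes\,\xi_0+\eta_0\,\tilde\otimes\,\xi,$$ where $\eta_0$ and $\xi_0$ are two fixed hyperplanes. Then the following diagram commutes: $$\begin{array}{ccc}\mathcal G^1(\mathbb P^\infty)\times\mathcal G^1(\mathbb P^\infty)&\xrightarrow{\ \otimes\ }&\mathcal G^1(\mathbb P^\infty)\\ {\scriptstyle i}\downarrow& &\downarrow{\scriptstyle i}\\ \mathcal Z^1(\mathbb P^\infty)\times\mathcal Z^1(\mathbb P^\infty)&\xrightarrow{\ \hat\otimes\ }&\mathcal Z^1(\mathbb P^\infty)\end{array}$$ where the maps $i$ are the inclusions of linear cycles shifted by a fixed hyperplane: $i(\eta,\xi)=(\eta-\eta_0,\xi-\xi_0)$ on the left and $i(\zeta)=\zeta-\eta_0\otimes\xi_0$ on the right.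
   Context: All projective spaces are over $\mathbb C$. $\mathcal C^1(\mathbb P^s)$ is the monoid of effective codimension-$1$ cycles in $\mathbb P^s$, identified with nonzero homogeneous polynomials in $x_0,\dots,x_s$ up to scalar; addition of cycles corresponds to multiplication of polynomials. $\mathcal Z^1(\mathbb P^s)$ is its group completion. $\mathcal C^1(\mathbb P^\infty)$ and $\mathcal Z^1(\mathbb P^\infty)$ are the stabilizations obtained by regarding polynomials as polynomials in more variables, and $\mathcal G^1(\mathbb P^\infty)$ is the space of hyperplanes (degree-$1$ effective cycles). Construction of $\tilde\otimes$: let $\Psi_{de}$ be the map, multilinear in $e$ polynomials of degree $d$ in the variables $x_j$ and $d$ polynomials of degree $e$ in the variables $y_k$, with values in polynomials of degree $de$ in variables $z_{jk}$, given on monomials (each written with indices in nondecreasing order) by $$\Psi_{de}\big(x_{j_1^1}\cdots x_{j_d^1},\dots,x_{j_1^e}\cdots x_{j_d^e},\,y_{k_1^1}\cdots y_{k_e^1},\dots,y_{k_1^d}\cdots y_{k_e^d}\big)=\prod_{a=1}^e\prod_{b=1}^d z_{j_b^ak_a^b}.$$ For $f$ of degree $d$ and $g$ of degree $e$ put $f\,\tilde\otimes\,g:=\Psi_{de}(f,\dots,f,g,\dots,g)$ ($e$ copies of $f$, $d$ copies of $g$). This gives a biadditive pairing $\mathcal C^1(\mathbb P^{n-1})\times\mathcal C^1(\mathbb P^{m-1})\to\mathcal C^1(\mathbb P^{mn-1})$ which stabilizes to $\mathbb P^\infty$ (the $z_{jk}$ being the coordinates of the target) and extends to the group completions. On hyperplanes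 it is the tensor product $\otimes$, $V(\sum a_jx_j)\otimes V(\sum b_ky_k)=V(\sum a_jb_kz_{jk})$, which classifies the tensor product of universal quotient line bundles.
   Formalization: The product of forms is not biadditive on all effective cycles (e.g. x0+x1, x0−x1 against y0²+y1²), so the pairing is taken to be any biadditive pairing on cycles that agrees with the product on irreducible cycles. *)

(* Defs.v *)
From HB Require Import structures.
From mathcomp Require Import all_boot all_order all_algebra.
From mathcomp Require Import finmap generic_quotient.
From mathcomp.multinomials Require Import monalg.
From mathcomp Require Import boolp.

Set Implicit Arguments.
Unset Strict Implicit.
Unset Printing Implicit Defensive.

Import GRing.Theory.
Local Open Scope ring_scope.
Local Open Scope quotient_scope.

Section GroupCompletion.
Variable M : nmodType.
Implicit Types (x y z : M * M) (a b : M).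

Definition gc_rel x y : bool :=
  `[< exists k : M, x.1 + y.2 + k = y.1 + x.2 + k >].

Lemma gc_rel_refl : reflexive gc_rel.
Proof. by move=> x; apply/asboolP; exists 0. Qed.

Lemma gc_rel_sym : symmetric gc_rel.
Proof. by move=> x y; apply: asbool_equiv_eq; split=> -[k h]; exists k. Qed.

Lemma gc_rel_trans : transitive gc_rel.
Proof.
move=> y x z /asboolP[k hk] /asboolP[l hl]; apply/asboolP.
exists (y.1 + y.2 + k + l).
rewrite [LHS](AC (2*4) ((1*4*5)*(3*2*6)))%AC /= hk hl.
by rewrite [RHS](AC (2*4) ((3*2*5)*(1*4*6)))%AC.
Qed.

Canonical gc_equiv := EquivRel gc_rel gc_rel_refl gc_rel_sym gc_rel_trans.

Definition group_completion := {eq_quot gc_equiv}.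
HB.instance Definition _ := Choice.on group_completion.
HB.instance Definition _ := EqQuotient.on group_completion.

Lemma gcP x y :
  reflect (exists k, x.1 + y.2 + k = y.1 + x.2 + k)
          (x == y %[mod group_completion]).
Proof.
by rewrite piE; apply: asboolP.
Qed.

Definition gc_zero : group_completion := \pi_group_completion (0, 0).

Definition gc_add (u v : group_completion) : group_completion :=
  \pi_group_completion ((repr u).1 + (repr v).1, (repr u).2 + (repr v).2).

Definition gc_opp (u : group_completion) : group_completion :=
  \pi_group_completion ((repr u).2, (repr u).1).

Lemma pi_gc_add x y :
  gc_add (\pi x) (\pi y) = \pi_group_completion (x.1 + y.1, x.2 + y.2).
Proof.
rewrite /gc_add; apply/eqP/gcP => /=.
case: piP => x' /eqP/gcP[k hk]; case: piP => y' /eqP/gcP[l hl].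
exists (k + l).
rewrite [LHS](AC (2*2*2) ((1*3*5)*(2*4*6)))%AC /= -hk -hl.
by rewrite [LHS](AC (3*3) ((1*4)*(2*5)*(3*6)))%AC.
Qed.

Lemma pi_gc_opp x : gc_opp (\pi x) = \pi_group_completion (x.2, x.1).
Proof.
rewrite /gc_opp; apply/eqP/gcP => /=.
case: piP => x' /eqP/gcP[k hk]; exists k.
by rewrite [_ + x.1]addrC [x.2 + _]addrC.
Qed.

Lemma gc_addA : associative gc_add.
Proof.
by move=> u v w; rewrite -[u]reprK -[v]reprK -[w]reprK !pi_gc_add /= !addrA.
Qed.

Lemma gc_addC : commutative gc_add.
Proof.
move=> u v; rewrite -[u]reprK -[v]reprK !pi_gc_add.
by congr (\pi_group_completion (_, _)); rewrite addrC.
Qed.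

Lemma gc_add0 : left_id gc_zero gc_add.
Proof.
by move=> u; rewrite -[u]reprK pi_gc_add /= !add0r; case: (repr u).
Qed.

Lemma gc_addN : left_inverse gc_zero gc_opp gc_add.
Proof.
move=> u; rewrite -[u]reprK pi_gc_opp pi_gc_add; apply/eqP/gcP.
by exists 0; rewrite /= !addr0 add0r addrC.
Qed.

HB.instance Definition _ :=
  GRing.isZmodule.Build group_completion gc_addA gc_addC gc_add0 gc_addN.

Definition gc_of a : group_completion := \pi_group_completion (a, 0).

Lemma gc_ofD a b : gc_of (a + b) = gc_of a + gc_of b.
Proof. by rewrite /gc_of [RHS]pi_gc_add /= addr0. Qed.

Lemma gc_of0 : gc_of 0 = 0.
Proof. by []. Qed.

End GroupCompletion.

(* Polynomials are elements of {malg K[{cmonom I}]}: coefficients in K,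
   variables x_i for i : I. Each polynomial involves finitely many variables,
   so infinite I gives the stabilization over all projective spaces. The
   cycles being paired live over I = nat (variables x_j, resp. y_k), their
   product over I = nat * nat (variables z_jk). *)

Section Scale.
Variables (K : fieldType) (M : conomType).

Lemma pol_scaleU (x y : K) (m : M) :
  x *: (<< y *g m >> : {malg K[M]}) = << x * y *g m >>.
Proof.
by apply/malgP => n; rewrite (mcoeffZ x) (mcoeffU m y) (mcoeffU m (x * y)) mulrnAr.
Qed.

Lemma msupp_scale (x : K) (f : {malg K[M]}) : x != 0 -> msupp (x *: f) = msupp f.
Proof. by move=> x0; rewrite msuppZ (negPf x0). Qed.

End Scale.

Section Forms.
Variables (K : fieldType) (I : choiceType).
Local Notation pol := {malg K[{cmonom I}]}.
Implicit Types (f g : pol) (m : {cmonom I}) (w : I -> nat).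

Definition pdeg f : nat := (msize f).-1.

(* Homogeneous polynomials of the given degree, 0 included. *)
Definition homogd d f : Prop := forall m, mdeg m != d -> f@_m = 0.

Lemma homogdM d e f g : homogd d f -> homogd e g -> homogd (d + e) (f * g).
Proof.
move=> hf hg m hm; rewrite mcoeffMl big1_seq // => m1 _.
rewrite big1_seq // => m2 _.
case: (eqVneq m (mmul m1 m2)) => [em|_]; last by rewrite mulr0n.
case: (eqVneq (mdeg m1) d) => [e1|/hf->]; last by rewrite mul0r mul0rn.
case: (eqVneq (mdeg m2) e) => [e2|/hg->]; last by rewrite mulr0 mul0rn.
by move: hm; rewrite em [mdeg _]mdegM e1 e2 eqxx.
Qed.

Lemma homogdZ d c f : homogd d f -> homogd d (c *: f).
Proof. by move=> hf m /hf h; rewrite mcoeffZ h mulr0. Qed.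

Lemma homogd_sum d (T : Type) (r : seq T) (P : pred T) (F : T -> pol) :
  (forall i, P i -> homogd d (F i)) -> homogd d (\sum_(i <- r | P i) F i).
Proof.
move=> h m hm; rewrite raddf_sum /= big1 // => i Pi; exact: h.
Qed.

Lemma homogdU d c m : mdeg m = d -> homogd d << c *g m >>.
Proof.
by move=> hm m'; rewrite mcoeffU -hm eq_sym; case: (eqVneq m m') => [->|//]; rewrite eqxx.
Qed.

Lemma homogd_pdeg d f : f != 0 -> homogd d f -> pdeg f = d.
Proof.
move=> f0 hf; rewrite /pdeg msizeE.
have hs m : m \in msupp f -> mdeg m = d.
  by rewrite -mcoeff_neq0; apply: contra_neqP => /eqP/hf.
rewrite (eq_big_seq (fun=> d.+1)) => [|m /hs->//].
move: f0; rewrite -msupp_eq0 => /fset0Pn[m hm].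
by rewrite (big_rem m) //= (maxn_idPl _) // big_tnth; apply/bigmax_leqP.
Qed.

Record form := Form {
  form_val :> {malg K[{cmonom I}]};
  form_axiom : (form_val != 0) && all (fun m => mdeg m == pdeg form_val) (msupp form_val)
}.
HB.instance Definition _ := [isSub for form_val].
HB.instance Definition _ := [Choice of form by <:].

Lemma form_neq0 (f : form) : (f : pol) != 0.
Proof. by case: f => f /= /andP[]. Qed.

Lemma form_homogd (f : form) : homogd (pdeg f) f.
Proof.
case: f => f /= /andP[_ /allP h] m; apply: contra_neqP; move/eqP.
by rewrite mcoeff_neq0 => /h/eqP.
Qed.

Arguments form_homogd : clear implicits.

Lemma form_subproof d f : f != 0 -> homogd d f ->
  (f != 0) && all (fun m => mdeg m == pdeg f) (msupp f).
Proof.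
move=> f0 hf; rewrite f0 (homogd_pdeg f0 hf); apply/allP => m.
by rewrite -mcoeff_neq0; apply: contra_neqT => /hf.
Qed.

(* Substitution of 'X^(w i) for x_i, used to show that there are no zero
   divisors. *)
Definition wt w m := (\sum_(i <- finsupp m) m i * w i)%N.

Lemma wtEw w m (d : {fset I}) : (finsupp m `<=` d)%fset ->
  wt w m = (\sum_(i <- d) m i * w i)%N.
Proof.
move=> le; rewrite /wt (big_fset_incl _ le) // => i _.
by rewrite memNfinsupp => /eqP->; rewrite mul0n.
Qed.

Lemma wtM w m1 m2 : wt w (mmul m1 m2) = (wt w m1 + wt w m2)%N.
Proof.
pose d := (finsupp m1 `|` finsupp m2)%fset.
rewrite (@wtEw w m1 d) ?fsubsetUl // (@wtEw w m2 d) ?fsubsetUr //.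
rewrite (@wtEw w _ d) ?mdomD // -big_split /=.
by apply: eq_bigr => i _; rewrite cmM mulnDl.
Qed.

Lemma wt1 w : wt w mone = 0%N.
Proof. by rewrite /wt mdom1 big_seq_fset0. Qed.

Lemma wtU w i : wt w (ucm i) = w i.
Proof. by rewrite /wt mdomU big_seq_fset1 cmUU mul1n. Qed.

Definition wt_monom w m : {poly K} := 'X^(wt w m).

Definition wt_subst w f : {poly K} := mmap polyC (wt_monom w) f.

Lemma wt_substU w c m : wt_subst w << c *g m >> = c%:P * 'X^(wt w m).
Proof. exact: mmapU. Qed.

Lemma wt_substD w : {morph wt_subst w : f g / f + g}.
Proof. exact: raddfD. Qed.

Lemma wt_subst_sum w (T : Type) (r : seq T) (P : pred T) (F : T -> pol) :
  wt_subst w (\sum_(i <- r | P i) F i) = \sum_(i <- r | P i) wt_subst w (F i).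
Proof. exact: raddf_sum. Qed.

Lemma wt_monom_mmorphism w : mmorphism (wt_monom w).
Proof. by split=> [m n|]; rewrite /wt_monom ?wt1 // wtM exprD. Qed.

HB.instance Definition _ w := isMultiplicative.Build {cmonom I} {poly K}
  (wt_monom w) (wt_monom_mmorphism w).

Lemma wt_substM w : {morph wt_subst w : f g / f * g}.
Proof. exact: (mmap_is_multiplicative (f := polyC) (h := wt_monom w)).1. Qed.

Lemma digits_inj N n (a b : nat -> nat) :
  (forall k, (k < n)%N -> (a k < N)%N /\ (b k < N)%N) ->
  (\sum_(k < n) a k * N ^ k = \sum_(k < n) b k * N ^ k)%N ->
  forall k, (k < n)%N -> a k = b k.
Proof.
elim: n a b => [//|n IHn] a b hab.
rewrite !big_ord_recl !expn0 !muln1.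
have E (c : nat -> nat) : (\sum_(i < n) c (bump 0 i) * N ^ (bump 0 i) =
    (\sum_(i < n) c i.+1 * N ^ i) * N)%N.
  by rewrite big_distrl; apply: eq_bigr => i _; rewrite /bump add1n expnSr mulnA.
rewrite !{}E => h; have [ha hb] := hab 0%N isT.
have e0 : a 0%N = b 0%N.
  by move/(congr1 (modn^~ N)): h; rewrite ![(_ + _ * N)%N]addnC !modnMDl !modn_small.
move: h; rewrite e0 => /addnI /eqP; rewrite eqn_pmul2r; last exact: leq_ltn_trans ha.
move/eqP => h [|k] hk //; apply: (IHn (fun k => a k.+1) (fun k => b k.+1)) => //.
by move=> j hj; apply: hab.
Qed.

Lemma wt_sep (s : {fset {cmonom I}}) : exists w, {in s &, injective (wt w)}.
Proof.
pose V : {fset I} := (\bigcup_(m <- s) finsupp m)%fset.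
pose N := (\max_(m <- s) \max_(i <- V) m i).+1.
have leV m : m \in s -> (finsupp m `<=` V)%fset by move=> ms; exact: bigfcup_sup.
have ltN m i : m \in s -> (m i < N)%N.
  move=> ms; rewrite ltnS; case: (finsuppP m i) => // im.
  have iV : i \in V by apply: (fsubsetP (leV _ ms)).
  apply: leq_trans (leq_bigmax_seq (F := fun n : {cmonom I} => \max_(j <- V) n j) m ms isT).
  exact: (leq_bigmax_seq (F := fun j => m j) i iV isT).
exists (fun i => N ^ index i V)%N => m m' ms ms'.
have E (n : {cmonom I}) : n \in s ->
    wt (fun i => N ^ index i V)%N n =
    (\sum_(k < size V) nth 0 [seq n i | i <- V] k * N ^ k)%N.
  move=> ns; rewrite (wtEw _ (leV _ ns)).
  case: (enum_fset V) (fset_uniq V) => [|i0 r] ur; first by rewrite big_nil big_ord0.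
  rewrite (big_nth i0) big_mkord; apply: eq_bigr => k _.
  by rewrite index_uniq // (nth_map i0).
rewrite !E // => h; apply/eqP/cmP => i.
case: (boolP (i \in V)) => iV; last first.
  have Z n : n \in s -> n i = 0%N.
    move=> ns; apply/eqP; rewrite -memNfinsupp; apply: contra iV.
    exact: (fsubsetP (leV _ ns)).
  by rewrite !Z.
have iVs : (index i V < size V)%N by rewrite index_mem.
have := digits_inj _ h iVs; rewrite !(nth_map i) // nth_index //; apply => k hk.
by rewrite !(nth_map i) //= !ltN.
Qed.

Lemma wt_subst_neq0 w f :
  {in msupp f &, injective (wt w)} -> f != 0 -> wt_subst w f != 0.
Proof.
move=> winj; rewrite -msupp_eq0 => /fset0Pn[m hm].
apply/eqP => /(congr1 (fun p : {poly K} => p`_(wt w m))).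
rewrite coef0 /wt_subst mmapE coef_sum (big_fsetD1 m) //= big1_seq => [|n].
  by rewrite coefCM coefXn eqxx mulr1 addr0 => /eqP; rewrite mcoeff_eq0 hm.
rewrite /= in_fsetD1 => /andP[nm ns].
rewrite coefCM coefXn; case: eqP => [/winj|_]; last by rewrite mulr0.
by move=> /(_ hm ns) e; rewrite e eqxx in nm.
Qed.

Lemma pol_mulf_neq0 f g : f != 0 -> g != 0 -> f * g != 0.
Proof.
have [w winj] := wt_sep (msupp f `|` msupp g)%fset.
have sub (s t : {fset {cmonom I}}) : (s `<=` t)%fset ->
    {in t &, injective (wt w)} -> {in s &, injective (wt w)}.
  by move=> /fsubsetP st h m n /st mt /st nt; exact: h.
move=> /(wt_subst_neq0 (sub _ _ (fsubsetUl _ _) winj)) f0.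
move=> /(wt_subst_neq0 (sub _ _ (fsubsetUr _ _) winj)) g0.
apply: contraNneq (mulf_neq0 f0 g0) => fg0.
by rewrite -wt_substM fg0 /wt_subst mmap0.
Qed.

Lemma pol_scale_neq0 (c : K) f : c != 0 -> f != 0 -> c *: f != 0.
Proof.
by move=> c0; rewrite -!msupp_eq0 msuppZ (negPf c0).
Qed.

Definition form_mul (f g : form) : form :=
  Form (form_subproof (pol_mulf_neq0 (form_neq0 f) (form_neq0 g))
                      (homogdM (form_homogd f) (form_homogd g))).

Lemma pol_one_neq0 : (1 : pol) != 0.
Proof. by rewrite oner_neq0. Qed.

Definition form_one : form :=
  Form (form_subproof pol_one_neq0 (homogdU 1 mdeg1)).

Lemma pdegM (f g : form) : pdeg ((f : pol) * g) = (pdeg f + pdeg g)%N.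
Proof.
apply: homogd_pdeg; first exact: form_neq0 (form_mul f g).
exact: homogdM (form_homogd f) (form_homogd g).
Qed.

Lemma pdegZ (c : K) (f : form) : c != 0 -> pdeg (c *: (f : pol)) = pdeg f.
Proof.
move=> c0; apply: homogd_pdeg; first exact: pol_scale_neq0 (form_neq0 f).
exact: homogdZ (form_homogd f).
Qed.

Definition proportional (f g : form) : bool :=
  `[< exists2 c : K, c != 0 & (g : pol) = c *: (f : pol) >].

Lemma proportional_refl : reflexive proportional.
Proof. by move=> f; apply/asboolP; exists 1; [exact: oner_neq0 | rewrite scale1r]. Qed.

Lemma proportional_sym : symmetric proportional.
Proof.
move=> f g; apply: asbool_equiv_eq.
by split=> -[c c0 h]; exists c^-1; rewrite ?invr_eq0;
  [exact: c0 | rewrite h scalerA mulVf ?scale1r | exact: c0 |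
   rewrite h scalerA mulVf ?scale1r].
Qed.

Lemma proportional_trans : transitive proportional.
Proof.
move=> g f h /asboolP[c c0 hc] /asboolP[d d0 hd]; apply/asboolP.
by exists (d * c); [exact: mulf_neq0 | rewrite hd hc; exact: scalerA].
Qed.

Canonical proportional_equiv :=
  EquivRel proportional proportional_refl proportional_sym proportional_trans.

(* Addition of cycles is multiplication of forms. *)
Definition C1 := {eq_quot proportional_equiv}.
HB.instance Definition _ := Choice.on C1.
HB.instance Definition _ := EqQuotient.on C1.

Definition C1_of (f : form) : C1 := \pi f.

Lemma C1P (f g : form) :
  reflect (exists2 c : K, c != 0 & (g : pol) = c *: (f : pol))
          (C1_of f == C1_of g).
Proof. by rewrite /C1_of piE; apply: asboolP. Qed.

Definition C1_zero : C1 := C1_of form_one.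
Definition C1_add (u v : C1) : C1 := C1_of (form_mul (repr u) (repr v)).

Lemma C1_reprK (u : C1) : C1_of (repr u) = u.
Proof. exact: reprK. Qed.

Lemma C1_repr (f : form) :
  exists2 c : K, c != 0 & (repr (C1_of f) : pol) = c *: (f : pol).
Proof. by apply/C1P; rewrite C1_reprK. Qed.

Lemma C1_ofM (f g : form) : C1_of (form_mul f g) = C1_add (C1_of f) (C1_of g).
Proof.
have [c c0 hc] := C1_repr f; have [d d0 hd] := C1_repr g.
apply/eqP/C1P; exists (c * d); first exact: mulf_neq0.
rewrite /= hc hd -scalerAl -scalerAr; exact: scalerA.
Qed.

Lemma C1_addA : associative C1_add.
Proof.
move=> u v w; rewrite -[u]C1_reprK -[v]C1_reprK -[w]C1_reprK -!C1_ofM.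
by congr C1_of; apply: val_inj; rewrite /= mulrA.
Qed.

Lemma C1_addC : commutative C1_add.
Proof. by move=> u v; congr C1_of; apply: val_inj; rewrite /= mulrC. Qed.

Lemma C1_add0 : left_id C1_zero C1_add.
Proof.
move=> u; rewrite -[u]C1_reprK -C1_ofM.
by congr C1_of; apply: val_inj; rewrite /= mul1r.
Qed.

HB.instance Definition _ :=
  GRing.isNmodule.Build C1 C1_addA C1_addC C1_add0.

Definition C1_deg (u : C1) : nat := pdeg (repr u).

Lemma C1_degE (f : form) : C1_deg (C1_of f) = pdeg f.
Proof. by have [c c0 hc] := C1_repr f; rewrite /C1_deg hc pdegZ. Qed.

(* Factors of a form are forms and 0 is the class of constants, so these are
   the classes of irreducible polynomials. *)
Definition C1_irreducible (u : C1) : Prop :=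
  u != 0 /\ forall v w : C1, u = v + w -> v = 0 \/ w = 0.

Definition Z1 := group_completion C1.

Definition G1 := {u : C1 | C1_deg u == 1%N}.

Definition pvars f : {fset I} := (\bigcup_(m <- msupp f) finsupp m)%fset.

End Forms.

Arguments form_homogd {K I} f m _.

Section Tensor.
Variable K : fieldType.
Local Notation pol := {malg K[{cmonom nat}]}.
Local Notation pol2 := {malg K[{cmonom (nat * nat)%type}]}.
Implicit Types (f g : pol) (m n : {cmonom nat}).

(* The indices of the variables of m, with multiplicity, in nondecreasing
   order. *)
Definition mvars m : seq nat :=
  sort leq (flatten [seq nseq (m j) j | j <- finsupp m]).

(* The value of Psi on monomials, with 0-based indices. The default 0%N is
   never used when the m a have degree d and the n b degree e. *)
Definition Psi_monom d e (m : 'I_e -> {cmonom nat}) (n : 'I_d -> {cmonom nat}) :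
    {cmonom (nat * nat)%type} :=
  \big[mmul/mone]_(a < e) \big[mmul/mone]_(b < d)
    ucm (nth 0%N (mvars (m a)) b, nth 0%N (mvars (n b)) a).

Definition Psi d e (f : 'I_e -> pol) (g : 'I_d -> pol) : pol2 :=
  \sum_(m : {dffun forall a : 'I_e, msupp (f a)})
  \sum_(n : {dffun forall b : 'I_d, msupp (g b)})
    << (\prod_a (f a)@_(val (m a))) * (\prod_b (g b)@_(val (n b)))
       *g Psi_monom (fun a => val (m a)) (fun b => val (n b)) >>.

Definition pol_tensor f g : pol2 :=
  Psi (fun _ : 'I_(pdeg g) => f) (fun _ : 'I_(pdeg f) => g).

Lemma sum_mvars (w : nat -> nat) m :
  (\sum_(j <- mvars m) w j = wt w m)%N.
Proof.
rewrite /mvars (perm_big _ (permEl (perm_sort _ _))) /= big_flatten big_map.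
by apply: eq_bigr => j _; rewrite big_nseq iter_addn_0 mulnC.
Qed.

Lemma size_mvars m : size (mvars m) = mdeg m.
Proof.
rewrite -sum1_size (sum_mvars (fun=> 1%N)) /wt /mdeg.
by apply: eq_bigr => i _; rewrite muln1.
Qed.

Lemma sum_nth_mvars (w : nat -> nat) m d : mdeg m = d ->
  (\sum_(b < d) w (nth 0 (mvars m) b) = wt w m)%N.
Proof.
by move=> <-; rewrite -sum_mvars (big_nth 0%N) big_mkord size_mvars.
Qed.

Lemma mdeg_Psi_monom d e (m : 'I_e -> {cmonom nat}) (n : 'I_d -> {cmonom nat}) :
  mdeg (Psi_monom m n) = (d * e)%N.
Proof.
rewrite /Psi_monom mdeg_prod (eq_bigr (fun=> d)) => [|a _].
  by rewrite sum_nat_const card_ord mulnC.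
rewrite mdeg_prod (eq_bigr (fun=> 1%N)) => [|b _]; last exact: mdegU.
by rewrite sum_nat_const card_ord muln1.
Qed.

Lemma Psi_homogd d e (f : 'I_e -> pol) (g : 'I_d -> pol) :
  homogd (d * e) (Psi f g).
Proof.
do 2![apply: homogd_sum => ? _]; apply: homogdU; exact: mdeg_Psi_monom.
Qed.

Lemma wt_prod (I : choiceType) (w : I -> nat) k (F : 'I_k -> {cmonom I}) :
  wt w (\big[mmul/mone]_(a < k) F a) = (\sum_(a < k) wt w (F a))%N.
Proof. by apply: (big_morph (wt w) (@wtM _ w) (wt1 w)). Qed.

Lemma wt_Psi_monom (w1 w2 : nat -> nat) d e
    (m : 'I_e -> {cmonom nat}) (n : 'I_d -> {cmonom nat}) :
  (forall a, mdeg (m a) = d) -> (forall b, mdeg (n b) = e) ->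
  wt (fun p => w1 p.1 + w2 p.2)%N (Psi_monom m n) =
  (\sum_a wt w1 (m a) + \sum_b wt w2 (n b))%N.
Proof.
move=> hm hn; rewrite /Psi_monom wt_prod.
rewrite (eq_bigr (fun a : 'I_e =>
    wt w1 (m a) + \sum_(b < d) w2 (nth 0 (mvars (n b)) a))%N); last first.
  move=> a _; rewrite wt_prod -(sum_nth_mvars w1 (hm a)) -big_split /=.
  by apply: eq_bigr => b _; rewrite wtU.
rewrite big_split /= exchange_big /=; congr addn.
by apply: eq_bigr => b _; rewrite sum_nth_mvars.
Qed.

Lemma wt_subst_Psi (w1 w2 : nat -> nat) d e f g :
  homogd d f -> homogd e g ->
  wt_subst (fun p => w1 p.1 + w2 p.2)%N
    (Psi (fun _ : 'I_e => f) (fun _ : 'I_d => g)) =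
  wt_subst w1 f ^+ e * wt_subst w2 g ^+ d.
Proof.
move=> hf hg.
have E (w : nat -> nat) (h : pol) k : wt_subst w h ^+ k =
    \sum_(m : {ffun 'I_k -> msupp h}) \prod_(a < k)
      ((h@_(val (m a)))%:P * 'X^(wt w (val (m a)))).
  rewrite -(bigA_distr_bigA (fun (_ : 'I_k) (s : msupp h) =>
             (h@_(val s))%:P * 'X^(wt w (val s)))).
  rewrite prodr_const card_ord; congr (_ ^+ _).
  by rewrite /wt_subst mmapE big_seq_fsetE.
rewrite !E mulr_suml /Psi wt_subst_sum; apply: eq_bigr => m _.
rewrite mulr_sumr wt_subst_sum; apply: eq_bigr => n _.
have hs k (h : pol) (s : msupp h) : homogd k h -> mdeg (val s) = k.
  move=> hh; apply/eqP; apply: contraTT (valP s) => /hh.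
  by rewrite -mcoeff_eq0 => ->.
rewrite wt_substU wt_Psi_monom => [|a|b]; try exact: hs.
rewrite !big_split /= exprD polyCM !rmorph_prod /=.
by rewrite !(big_morph (fun k => 'X^k : {poly K}) (@exprD _ 'X) (expr0 _)) mulrACA.
Qed.

Lemma pol_tensor_neq0 (f g : form K nat) : pol_tensor f g != 0.
Proof.
have [w1 i1] := wt_sep (msupp (f : pol)); have [w2 i2] := wt_sep (msupp (g : pol)).
have h := wt_subst_Psi w1 w2 (form_homogd f) (form_homogd g).
have : wt_subst (fun p => w1 p.1 + w2 p.2)%N (pol_tensor f g) != 0.
  by rewrite h mulf_neq0 // expf_neq0 // wt_subst_neq0 // form_neq0.
by apply: contraNneq => ->; rewrite /wt_subst mmap0.
Qed.

Definition form_tensor (f g : form K nat) : form K (nat * nat)%type :=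
  Form (form_subproof (pol_tensor_neq0 f g) (@Psi_homogd _ _ _ _)).

Definition C1_tensor (u v : C1 K nat) : C1 K (nat * nat)%type :=
  C1_of (form_tensor (repr u) (repr v)).

Let Psi_on (S T : {fset {cmonom nat}}) (cf cg : {cmonom nat} -> K) d e : pol2 :=
  \sum_(m : {dffun forall a : 'I_e, S}) \sum_(n : {dffun forall b : 'I_d, T})
    << (\prod_a cf (val (m a))) * (\prod_b cg (val (n b)))
       *g Psi_monom (fun a => val (m a)) (fun b => val (n b)) >>.

Lemma Psi_scale d e (c c' : K) f g : c != 0 -> c' != 0 ->
  Psi (fun _ : 'I_e => c *: f) (fun _ : 'I_d => c' *: g) =
  (c ^+ e * c' ^+ d) *: Psi (fun _ : 'I_e => f) (fun _ : 'I_d => g).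
Proof.
move=> c0 c'0.
have gen S T (eS : S = msupp f) (eT : T = msupp g) :
    Psi_on S T (mcoeff^~ (c *: f)) (mcoeff^~ (c' *: g)) d e =
    (c ^+ e * c' ^+ d) *: Psi (fun _ : 'I_e => f) (fun _ : 'I_d => g).
  rewrite {}eS {}eT /Psi_on /Psi scaler_sumr.
  apply: eq_bigr => m _; rewrite scaler_sumr; apply: eq_bigr => n _.
  rewrite pol_scaleU; congr (<< _ *g _ >>).
  rewrite (eq_bigr (fun a => c * f@_(val (m a)))) => [|a _]; last exact: mcoeffZ.
  rewrite [X in _ * X = _](eq_bigr (fun b => c' * g@_(val (n b)))) => [|b _];
    last exact: mcoeffZ.
  by rewrite !big_split /= !prodr_const !card_ord mulrACA.
exact: gen (msupp_scale f c0) (msupp_scale g c'0).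
Qed.

Lemma C1_tensorE (f g : form K nat) :
  C1_tensor (C1_of f) (C1_of g) = C1_of (form_tensor f g).
Proof.
have [c c0 hc] := C1_repr f; have [d d0 hd] := C1_repr g.
apply/eqP; rewrite eq_sym; apply/C1P.
exists (c ^+ pdeg g * d ^+ pdeg f); first by rewrite mulf_neq0 ?expf_neq0.
rewrite /= {1}/pol_tensor hc hd.
have gen k l (ek : k = pdeg g) (el : l = pdeg f) :
    Psi (fun _ : 'I_k => c *: (f : pol)) (fun _ : 'I_l => d *: (g : pol)) =
    (c ^+ pdeg g * d ^+ pdeg f) *: pol_tensor f g.
  by rewrite ek el; exact: Psi_scale.
exact: gen (pdegZ g d0) (pdegZ f c0).
Qed.

(* For f = \sum_j a_j x_j and g = \sum_k b_k y_k this is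
   \sum_(j, k) a_j b_k z_jk. *)
Definition lin_tensor f g : pol2 :=
  \sum_(j <- pvars f) \sum_(k <- pvars g)
    << f@_(ucm j) * g@_(ucm k) *g ucm (j, k) >>.

Lemma lin_tensor_homogd f g : homogd 1 (lin_tensor f g).
Proof. by do 2![apply: homogd_sum => ? _]; apply: homogdU; exact: mdegU. Qed.

Lemma ucm_inj (I : choiceType) : injective (@ucm I).
Proof.
move=> i j /(congr1 (fun m : {cmonom I} => m i)); rewrite !cmU eqxx.
by case: eqVneq.
Qed.

Lemma pvarsP f j : f@_(ucm j) != 0 -> j \in pvars f.
Proof.
rewrite mcoeff_neq0 => h; apply/bigfcupP; exists (ucm j); first by rewrite h.
by rewrite mdomU inE.
Qed.

Lemma mcoeff_lin_tensor f g j k :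
  (lin_tensor f g)@_(ucm (j, k)) = f@_(ucm j) * g@_(ucm k).
Proof.
have [f0|/pvarsP hj] := eqVneq (f@_(ucm j)) 0.
  rewrite f0 mul0r /lin_tensor raddf_sum /= big1 // => j' _.
  rewrite raddf_sum /= big1 // => k' _; rewrite mcoeffU.
  case: eqP => [/ucm_inj[-> _]|_]; last by rewrite mulr0n.
  by rewrite f0 mul0r.
have [g0|/pvarsP hk] := eqVneq (g@_(ucm k)) 0.
  rewrite g0 mulr0 /lin_tensor raddf_sum /= big1 // => j' _.
  rewrite raddf_sum /= big1 // => k' _; rewrite mcoeffU.
  case: eqP => [/ucm_inj[_ ->]|_]; last by rewrite mulr0n.
  by rewrite g0 mulr0.
rewrite /lin_tensor raddf_sum (big_fsetD1 j) //= [X in _ + X]big1_seq ?addr0.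
  rewrite raddf_sum (big_fsetD1 k) //= [X in _ + X]big1_seq ?addr0.
    by rewrite mcoeffUU.
  move=> k'; rewrite /= in_fsetD1 => /andP[nk _].
  by rewrite mcoeffU; case: eqP => [/ucm_inj[ek]|//]; rewrite ek eqxx in nk.
move=> j'; rewrite /= in_fsetD1 => /andP[nj _].
rewrite raddf_sum /= big1 // => k' _.
by rewrite mcoeffU; case: eqP => [/ucm_inj[ej _]|//]; rewrite ej eqxx in nj.
Qed.

Lemma linear_coeff f : f != 0 -> homogd 1 f -> exists j, f@_(ucm j) != 0.
Proof.
rewrite -msupp_eq0 => /fset0Pn[m ms] hf.
have dm : mdeg m = 1%N.
  by apply/eqP; move: ms; rewrite -mcoeff_neq0; apply: contraNT => /hf/eqP.
have [j jm] : exists j, j \in finsupp m.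
  apply/fset0Pn; apply/eqP => e; move: dm.
  by rewrite mdegE e big_seq_fset0.
exists j; suff -> : ucm j = m by rewrite mcoeff_neq0.
have hd : finsupp m = [fset j]%fset.
  apply/eqP; rewrite eq_sym eqEfsubset fsub1set jm /=; apply/fsubsetP => k km.
  rewrite inE; apply/eqP; apply/eqP/negPn/negP => nkj.
  move: dm; rewrite mdegE (big_fsetD1 j) // (big_fsetD1 k) /=; last first.
    by rewrite !inE nkj.
  move: jm km; rewrite -!cmE_neq0 -!lt0n.
  by case: (m j) => // a _; case: (m k) => // b _; rewrite addSn addnS.
apply/esym/eqP/cmP => i; rewrite cmU.
case: (eqVneq j i) => [<-|ji]; first by move: dm; rewrite mdegE hd big_seq_fset1.
by apply/eqP; rewrite cmE_eq0 hd inE eq_sym.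
Qed.

Lemma lin_tensor_neq0 f g : f != 0 -> homogd 1 f -> g != 0 -> homogd 1 g ->
  lin_tensor f g != 0.
Proof.
move=> f0 hf g0 hg.
have [j hj] := linear_coeff f0 hf; have [k hk] := linear_coeff g0 hg.
apply: contraNneq (mulf_neq0 hj hk).
by rewrite -mcoeff_lin_tensor => ->; rewrite mcoeff0.
Qed.

Lemma lin_tensor_scale (c d : K) f g : c != 0 -> d != 0 ->
  lin_tensor (c *: f) (d *: g) = (c * d) *: lin_tensor f g.
Proof.
move=> c0 d0.
have gen (S T : {fset nat}) (eS : S = pvars f) (eT : T = pvars g) :
    \sum_(j <- S) \sum_(k <- T)
      << (c *: f)@_(ucm j) * (d *: g)@_(ucm k) *g ucm (j, k) >> =
    (c * d) *: lin_tensor f g.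
  rewrite {}eS {}eT /lin_tensor scaler_sumr.
  apply: eq_bigr => j _; rewrite scaler_sumr; apply: eq_bigr => k _.
  by rewrite pol_scaleU (mcoeffZ c) (mcoeffZ d) mulrACA.
by apply: gen; rewrite /pvars; [have := msupp_scale f c0 | have := msupp_scale g d0] => ->.
Qed.

Lemma G1_neq0 (I : choiceType) (u : G1 K I) : (repr (val u) : {malg K[{cmonom I}]}) != 0.
Proof. exact: form_neq0. Qed.

Lemma G1_homogd (I : choiceType) (u : G1 K I) :
  homogd 1 (repr (val u) : {malg K[{cmonom I}]}).
Proof.
have h := form_homogd (repr (val u)).
have e : pdeg (repr (val u)) = 1%N := eqP (valP u).
by rewrite e in h.
Qed.

Definition G1_tensor_form (u v : G1 K nat) : form K (nat * nat)%type :=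
  Form (form_subproof
    (lin_tensor_neq0 (@G1_neq0 _ u) (@G1_homogd _ u) (@G1_neq0 _ v) (@G1_homogd _ v))
    (@lin_tensor_homogd _ _)).

Lemma G1_tensor_subproof (u v : G1 K nat) : C1_deg (C1_of (G1_tensor_form u v)) == 1%N.
Proof.
rewrite C1_degE; apply/eqP/homogd_pdeg; first exact: form_neq0.
exact: lin_tensor_homogd.
Qed.

Definition G1_tensor (u v : G1 K nat) : G1 K (nat * nat)%type :=
  exist _ (C1_of (G1_tensor_form u v)) (G1_tensor_subproof u v).

Lemma G1_tensorE (u v : G1 K nat) (f g : form K nat) :
  val u = C1_of f -> val v = C1_of g ->
  exists h : form K (nat * nat)%type,
    val (G1_tensor u v) = C1_of h /\ (h : pol2) = lin_tensor f g.
Proof.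
move=> eu ev.
have [c c0 hc] := C1_repr f; have [d d0 hd] := C1_repr g.
rewrite -eu in hc; rewrite -ev in hd.
have cd0 : (c * d)^-1 != 0 by rewrite invr_eq0 mulf_neq0.
have E : lin_tensor f g = (c * d)^-1 *: (G1_tensor_form u v : pol2).
  rewrite /= hc hd lin_tensor_scale //.
  apply/esym; apply: etrans (scalerA _ _ _) _.
  by rewrite mulVf ?scale1r // mulf_neq0.
have n0 : lin_tensor f g != 0 by rewrite E pol_scale_neq0 // form_neq0.
exists (Form (form_subproof n0 (@lin_tensor_homogd _ _))); split=> //.
by apply/eqP/C1P; exists (c * d)^-1.
Qed.

End Tensor.

Section Pairings.
Variable K : fieldType.
Local Notation Zsrc := (Z1 K nat).
Local Notation Ztgt := (Z1 K (nat * nat)%type).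
Implicit Types (T : Zsrc -> Zsrc -> Ztgt).

Definition biadditive T : Prop :=
  (forall x y z, T (x + y) z = T x z + T y z) /\
  (forall x y z, T x (y + z) = T x y + T x z).

(* Effective cycles are the sums of irreducible ones, so a biadditive pairing
   is determined by its values on irreducible cycles. Agreement with
   C1_tensor is not required on reducible cycles because C1_tensor itself is
   not additive: with f = x_0 + x_1, f' = x_0 - x_1, g = y_0 ^ 2 + y_1 ^ 2,
   the form (f f') tensor g has no monomial z_00 ^ 2 z_11 ^ 2, while
   (f tensor g) (f' tensor g) has it with coefficient 2. *)
Definition induced_by_tensor T : Prop :=
  biadditive T /\
  forall u v : C1 K nat, C1_irreducible u -> C1_irreducible v ->
    T (gc_of u) (gc_of v) = gc_of (C1_tensor u v).

Lemma induced_by_tensor_effective T : biadditive T ->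
  (forall u v, T (gc_of u) (gc_of v) = gc_of (C1_tensor u v)) ->
  induced_by_tensor T.
Proof. by move=> bT hT; split=> // u v _ _; exact: hT. Qed.

Definition reduced_pairing T (eta0 xi0 eta xi : Zsrc) : Ztgt :=
  T eta xi + T eta xi0 + T eta0 xi.

End Pairings.

Definition G1_cycle (K : fieldType) (I : choiceType) (h : G1 K I) : Z1 K I :=
  gc_of (val h).

Definition shifted_incl (K : fieldType) (I : choiceType) (h0 h : G1 K I) :
    Z1 K I :=
  G1_cycle h - G1_cycle h0.

(* Main.v *)
(** A biadditive T satisfies
    T (x - x0) (y - y0) + T (x - x0) y0 + T x0 (y - y0) = T x y - T x0 y0,
    so it suffices to compute T on hyperplanes. Degree is additive on cycles,
    hence hyperplanes are irreducible and T is given on them by the form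
    Psi(f, g) with f and g linear. A linear form is a combination of
    variables x_j, and Psi maps (x_j, y_k) to z_jk, so Psi is the bilinear
    tensor product. *)
Require Import Defs.
From mathcomp Require Import all_boot all_algebra.
From mathcomp Require Import reals.
From mathcomp.real_closed Require Import complex.
From mathcomp Require Import finmap.
From mathcomp.multinomials Require Import monalg.
Import GRing.Theory.
Local Open Scope ring_scope.

Section Degree.
Variables (K : fieldType) (I : choiceType).
Implicit Types (u v : C1 K I).

Lemma C1_degD u v : C1_deg (u + v) = (C1_deg u + C1_deg v)%N.
Proof.
rewrite -[u]C1_reprK -[v]C1_reprK.
by rewrite -[C1_of _ + C1_of _]C1_ofM !C1_degE; exact: pdegM.
Qed.

(** In degree 0 only the monomial [mone] can occur, so the form is a nonzero constant, proportional
    to the form 1. *)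
Lemma C1_deg_eq0 u : C1_deg u = 0%N -> u = 0.
Proof.
move=> u0; have hf := form_homogd (repr u); rewrite -/(C1_deg u) u0 in hf.
set f : {malg K[{cmonom I}]} := repr u.
have E : f = f@_mone *: 1.
  apply/malgP => m; rewrite mcoeffZ mcoeff1.
  have [->|m1] := eqVneq m mone; first by rewrite mulr1.
  by rewrite mulr0 hf // mdeg_eq0.
rewrite -[u]C1_reprK; apply/esym/eqP/C1P.
exists f@_mone; last exact: E.
by apply: contraTneq (form_neq0 (repr u)) => c0; rewrite -/f E c0 scale0r eqxx.
Qed.

Lemma C1_deg1_irreducible u : C1_deg u = 1%N -> C1_irreducible u.
Proof.
move=> u1; split=> [|v w uE].
  (* The zero cycle is the class of the constant 1, which has degree 0. *)
  apply: contra_eq_neq u1 => ->; rewrite C1_degE.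
  by rewrite (homogd_pdeg (@pol_one_neq0 K I) (homogdU 1 mdeg1)).
have := C1_degD v w; rewrite -uE u1.
case dv: (C1_deg v) => [|n]; first by left; exact: C1_deg_eq0.
case dw: (C1_deg w) => [|k]; first by right; exact: C1_deg_eq0.
by rewrite addSn addnS.
Qed.

End Degree.

Lemma mdeg1_ucm (m : {cmonom nat}) : mdeg m = 1%N -> exists j, m = ucm j.
Proof.
(* The monomial is viewed as a linear form; [rat] is just a convenient coefficient field. *)
move=> m1; have [||j] := @linear_coeff rat << m >>.
- by rewrite -msupp_eq0 msuppU1 -cardfs_eq0 cardfs1.
- exact: homogdU.
by rewrite mcoeffU; have [->|_] := eqVneq m (ucm j); [exists j | rewrite eqxx].
Qed.

Lemma nth_mvarsU j : nth 0%N (mvars (ucm j)) 0 = j.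
(* With the identity as weight, the sum over the single position is the index itself. *)
Proof. by have := sum_nth_mvars id (mdegU j); rewrite big_ord1 wtU. Qed.

Section LinearForms.
Variable K : fieldType.
Implicit Types (f g : {malg K[{cmonom nat}]}).

(** Serves to reindex the sums over monomials in [Psi] by variables, as in [lin_tensor]. *)
Lemma msupp_linear f : homogd 1 f ->
  perm_eq (msupp f) [seq ucm j | j <- pvars f].
Proof.
move=> hf.
have lin m : m \in msupp f -> exists j, m = ucm j.
  rewrite -mcoeff_neq0 => fm; apply: mdeg1_ucm.
  by apply/eqP; apply: contraNT fm => /hf/eqP.
apply: uniq_perm; rewrite ?map_inj_uniq ?fset_uniq //; first exact: ucm_inj.
move=> m; apply/idP/mapP => [mf|[j /bigfcupP[n /andP[nf _] jn] ->]].
  have [j mj] := lin m mf; exists j => //.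
  by apply: pvarsP; rewrite -mj mcoeff_neq0.
(* The support monomial [n] in which x_j occurs is itself a variable, hence x_j. *)
have [i ni] := lin n nf; move: jn; rewrite ni mdomU inE => /eqP->.
by rewrite -ni.
Qed.

(** A function on a one-point set amounts to its value; this turns the multilinear expansion of
    [Psi] into a double sum over monomials. *)
Lemma big_dffun1 (V : nmodType) (S : finType) (F : {dffun 'I_1 -> S} -> V) :
  \sum_(m : {dffun 'I_1 -> S}) F m = \sum_(s : S) F [ffun=> s].
Proof.
rewrite (reindex (fun s : S => [ffun=> s] : {dffun 'I_1 -> S})) //=.
exists (fun m : {dffun 'I_1 -> S} => m ord0) => [s _|m _].
  by rewrite ffunE.
by apply/ffunP => i; rewrite ffunE (ord1 i).
Qed.

Lemma Psi_linear f g : homogd 1 f -> homogd 1 g ->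
  Psi (fun _ : 'I_1 => f) (fun _ : 'I_1 => g) = lin_tensor f g.
Proof.
move=> hf hg; rewrite /Psi big_dffun1.
under eq_bigr => m _ do rewrite big_dffun1.
transitivity (\sum_(m <- msupp f) \sum_(n <- msupp g)
  << f@_m * g@_n *g ucm (nth 0%N (mvars m) 0, nth 0%N (mvars n) 0) >>).
  rewrite big_seq_fsetE; apply: eq_bigr => m _.
  rewrite big_seq_fsetE; apply: eq_bigr => n _.
  by rewrite /Psi_monom !big_ord1 !ffunE.
rewrite (perm_big _ (msupp_linear _ hf)) big_map; apply: eq_bigr => j _.
rewrite (perm_big _ (msupp_linear _ hg)) big_map; apply: eq_bigr => k _.
by rewrite !nth_mvarsU.
Qed.

Lemma C1_tensor_linear (u v : G1 K nat) :
  C1_tensor (val u) (val v) = val (G1_tensor u v).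
Proof.
congr C1_of; apply: val_inj => /=; rewrite /pol_tensor.
(* The degrees give the numbers of copies fed to [Psi], here one of each form. *)
have -> : pdeg (repr (val u)) = 1%N := eqP (valP u).
have -> : pdeg (repr (val v)) = 1%N := eqP (valP v).
by apply: Psi_linear; exact: G1_homogd.
Qed.

Lemma induced_by_tensor_G1 T (u v : G1 K nat) : induced_by_tensor T ->
  T (G1_cycle u) (G1_cycle v) = G1_cycle (G1_tensor u v).
Proof.
move=> [_ hT]; rewrite /G1_cycle -C1_tensor_linear; apply: hT.
- exact: C1_deg1_irreducible (eqP (valP u)).
- exact: C1_deg1_irreducible (eqP (valP v)).
Qed.

Lemma reduced_pairing_shift T x0 y0 x y : @biadditive K T ->
  reduced_pairing T x0 y0 (x - x0) (y - y0) = T x y - T x0 y0.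
Proof.
move=> [TDl TDr]; rewrite /reduced_pairing -TDr subrK.
(* The first two terms have merged into [T (x - x0) y]. Moving [T x0 y0] across completes
   [T x0 (y - y0)] to [T x0 y]. *)
by apply/esym/eqP; rewrite subr_eq -addrA -TDr subrK -TDl subrK.
Qed.

End LinearForms.

Theorem theorem2p10 (R : realType)
    (T : Z1 R[i] nat -> Z1 R[i] nat -> Z1 R[i] (nat * nat)%type)
    (T_induced : induced_by_tensor T)
    (eta0 xi0 : G1 R[i] nat) (eta xi : G1 R[i] nat) :
  reduced_pairing T (G1_cycle eta0) (G1_cycle xi0)
    (shifted_incl eta0 eta) (shifted_incl xi0 xi) =
  shifted_incl (G1_tensor eta0 xi0) (G1_tensor eta xi).
Proof.
rewrite /shifted_incl (reduced_pairing_shift _ _ _ _ _ _ T_induced.1).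
by rewrite !induced_by_tensor_G1.
Qed.
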